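(* Let $C\subset\mathbb{R}^n$ be nonempty, compact and convex, let $U\subset\mathbb{R}^n$ be open and convex with $C\cap U\neq\emptyset$, and let $f:U\to\mathbb{R}$ be twice continuously differentiable and convex. Assume boundary blow-up: for every $\alpha\in\mathbb{R}$ such that $L_\alpha:=\{p\in C\cap U\mid f(p)\le\alpha\}$ is nonempty, $\operatorname{dist}(L_\alpha,U^c)>0$. Then the problem of minimizing $f(p)$ subject to $p\in C\cap U$ has an optimal solution. Moreover, for fixed $p^{(0)}\in C\cap U$, if $f$ is strictly convex on $\mathcal F^{(0)}:=\{p\in C\cap U\mid f(p)\le f(p^{(0)})\}$, then the optimal solution is unique.
   Context: $U^c=\mathbb{R}^n\setminus U$ and $\operatorname{dist}(A,B)=\inf\{\|a-b\|: a\in A,b\in B\}$ (Euclidean norm), with the convention $\operatorname{dist}(A,\emptyset)=+\infty$. *)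

(* Defs.v *)
From mathcomp Require Import all_boot all_order all_algebra.
From mathcomp Require Import all_classical all_reals all_analysis.
Import Order.TTheory GRing.Theory Num.Theory.
Import numFieldNormedType.Exports.

Set Implicit Arguments.
Unset Strict Implicit.
Unset Printing Implicit Defensive.

Local Open Scope classical_set_scope.
Local Open Scope ring_scope.
Local Open Scope convex_scope.

(* The canonical norm of ['rV[R]_n] is the sup norm; the topology it induces is
   the Euclidean one, but distances have to be computed with [enorm]. *)
Definition enorm (R : realType) (n : nat) (x : 'rV[R]_n) : R :=
  Num.sqrt (\sum_(i < n) x 0 i ^+ 2).

(* [ereal_inf set0 = +oo], hence [dist A set0 = +oo]. *)
Definition dist (R : realType) (n : nat) (A B : set 'rV[R]_n) : \bar R :=
  ereal_inf [set (enorm (a - b))%:E | a in A & b in B].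

Definition partial (R : realType) (n : nat) (i : 'I_n) (f : 'rV[R]_n -> R) :
    'rV[R]_n -> R :=
  fun p => 'D_(delta_mx 0 i) f p.

(* [f] is of class C^k on the open set [U]: all its partial derivatives of
   order at most [k] exist and are continuous on [U]. As [U] is open, this
   does not depend on the values of [f] outside [U]. *)
Fixpoint class_C (R : realType) (n k : nat) (U : set 'rV[R]_n)
    (f : 'rV[R]_n -> R) : Prop :=
  (forall p, U p -> {for p, continuous f}) /\
  (if k is k'.+1 then
     forall i : 'I_n,
       (forall p, U p -> derivable f p (delta_mx 0 i)) /\
       class_C k' U (partial i f)
   else True).

(* The strict analogue of the library's [convex_function]. *)
Definition strictly_convex_function (R : numFieldType) (E : lmodType R)
    (E' := convex_lmodType E) (D : set E') (f : E' -> R^o) :=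
  forall t : {i01 R}, 0 < t%:num -> t%:num < 1 ->
    {in D &, forall x y : E', x != y -> f (x <| t |> y) < f x <| t |> f y}.

Definition sublevel (R : realType) (n : nat) (A : set 'rV[R]_n)
    (f : 'rV[R]_n -> R) (a : R) : set 'rV[R]_n :=
  [set p | A p /\ f p <= a].

Definition minimizer (R : realType) (n : nat) (A : set 'rV[R]_n)
    (f : 'rV[R]_n -> R) (p : 'rV[R]_n) : Prop :=
  A p /\ forall q, A q -> f p <= f q.

(* Main.v *)
Require Import Defs.
From mathcomp Require Import all_boot all_order all_algebra.
From mathcomp Require Import all_classical all_reals all_analysis.
Import Order.TTheory GRing.Theory Num.Theory.
Import numFieldNormedType.Exports.
Local Open Scope classical_set_scope.
Local Open Scope ring_scope.

(** Existence is the Weierstrass theorem on one sublevel set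
    L = {p in C `&` U | f p <= f p1}, with p1 any feasible point: minimizing f
    over C `&` U amounts to minimizing it over L, so it is enough that L be
    compact. As L lies in the compact set C, it remains to see that it is
    closed. A limit point p of L belongs to C; it belongs to U because
    otherwise dist L (~` U) would vanish, against the blow-up assumption; and
    once p is in U, continuity of f at p gives f p <= f p1
    ([sublevel_compact]).

    Uniqueness is the midpoint argument: two distinct minimizers both lie in
    the sublevel set of f p0, so strict convexity there puts f strictly below
    the minimum at their midpoint, which is feasible as C `&` U is convex
    ([minimizer_unique]). *)

Lemma enorm0 (R : realType) (n : nat) : enorm (0 : 'rV[R]_n) = 0.
Proof. by rewrite /enorm big1 ?sqrtr0// => i _; rewrite mxE expr0n. Qed.

(** The topology of ['rV[R]_n] is generated by the sup norm, whereas [dist] is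
    measured with [enorm]; this continuity is what links limit points to
    [dist]. *)
Lemma enorm_continuous (R : realType) (n : nat) :
  continuous (@enorm R n).
Proof.
have sum_sqr_cont : continuous (fun x : 'rV[R]_n => \sum_(i < n) x 0 i ^+ 2).
  refine (continuous_big (U := R^o) (@add_continuous R^o) (r := index_enum _)
    (P := xpredT) (F := fun i (x : 'rV[R]_n) => x 0 i ^+ 2) _) => i _ x.
  apply: (@continuous_comp _ _ _ (fun x : 'rV[R]_n => x 0 i)
    (fun r : R => r ^+ 2)); first exact: coord_continuous.
  exact: exprn_continuous.
move=> x; apply: (@continuous_comp _ _ _ _ (@Num.sqrt R)).
  exact: sum_sqr_cont.
exact: sqrt_continuous.
Qed.

Lemma dist_closure_le0 (R : realType) (n : nat) (A B : set 'rV[R]_n) (p : 'rV[R]_n) :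
  closure A p -> B p -> (dist A B <= 0)%E.
Proof.
move=> clAp Bp; apply/lee_addgt0Pr => e e0; rewrite add0e.
have near_p : nbhs p [set a | enorm (a - p) < e].
  have cvg0 : enorm (a - p) @[a --> p] --> (0 : R).
    have sub_cvg : a - p @[a --> p] --> (0 : 'rV[R]_n).
      rewrite -(subrr p).
      exact: (@cvgB R 'rV[R]_n _ (nbhs p) _ id (cst p)) cvg_id (cvg_cst _).
    rewrite -(enorm0 R n).
    by apply: (cvg_comp _ _ sub_cvg); exact: enorm_continuous.
  exact: (cvgr_lt _ cvg0).
have [a [Aa /= ae]] := clAp _ near_p.
apply: (@le_trans _ _ (enorm (a - p))%:E); last by rewrite lee_fin ltW.
by apply: ereal_inf_lbound; exists a => //; exists p.
Qed.

(** The positive distance to the complement of U keeps limit points of the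
    sublevel set inside U, where continuity of f then keeps their values at
    most a; so the sublevel set is closed in the compact set C. *)
Lemma sublevel_compact (R : realType) (n : nat) (C U : set 'rV[R]_n)
    (f : 'rV[R]_n -> R) (a : R) :
  compact C -> (forall p, U p -> {for p, continuous f}) ->
  (0 < dist (sublevel (C `&` U) f a) (~` U))%E ->
  compact (sublevel (C `&` U) f a).
Proof.
move=> C_compact f_cont dist_gt0.
apply: (subclosed_compact _ C_compact); last by move=> x [[]].
move=> p clp.
have Up : U p.
  apply: contrapT => nUp; move: dist_gt0.
  by rewrite ltNge (dist_closure_le0 _ _ _ _ _ clp nUp).
split; first split=> //.
  apply: (compact_closed (@norm_hausdorff _ _) C_compact).
  by apply: closureS clp => x [[]].
(* If f p exceeded a, so would f near p, hence at some sublevel point. *)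
rewrite leNgt; apply/negP => afp.
have [x [[_ fxa] /= afx]] := clp _ (cvgr_gt _ (f_cont _ Up) _ afp).
by move: afx; rewrite ltNge fxa.
Qed.

(** Points outside the sublevel set have values above a, hence cannot beat a
    minimizer of the sublevel set. *)
Lemma minimizer_exists (R : realType) (n : nat) (A : set 'rV[R]_n)
    (f : 'rV[R]_n -> R) (a : R) :
  sublevel A f a !=set0 -> compact (sublevel A f a) ->
  (forall p, A p -> {for p, continuous f}) ->
  exists p, minimizer A f p.
Proof.
move=> L_neq0 L_compact f_cont.
have [|c /set_mem[Ac fca] c_min] := compact_EVT_min L_neq0 L_compact (f := f).
  by apply: continuous_in_subspaceT => x /set_mem[Ax _]; exact: f_cont.
exists c; split => // q Aq; have [fqa|/ltW afq] := leP (f q) a.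
  by apply: c_min; rewrite inE.
exact: le_trans fca afq.
Qed.

(** Minimizers have value at most [f p0], so strict convexity applies to them;
    if they differed, f would be below its minimum at their midpoint, which
    lies in A by convexity. *)
Lemma minimizer_unique (R : realType) (n : nat) (A : set 'rV[R]_n)
    (f : 'rV[R]_n -> R) (p0 p q : 'rV[R]_n) :
  convex_set A -> A p0 -> strictly_convex_function (sublevel A f (f p0)) f ->
  minimizer A f p -> minimizer A f q -> p = q.
Proof.
move=> A_convex Ap0 f_sconvex [Ap p_min] [Aq q_min].
apply: contrapT => /eqP pq.
have fpq : f p = f q by apply/eqP; rewrite eq_le p_min// q_min.
have half_ge0 : 0 <= 2^-1 :> R by rewrite invr_ge0.
have half_le1 : 2^-1 <= 1 :> R by rewrite invf_le1// ler1n.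
pose t : {i01 R} := Itv01 half_ge0 half_le1.
have Am : A (conv t (p : convex_lmodType _) q).
  by apply: set_mem; apply: A_convex; rewrite inE.
have t_gt0 : 0 < t%:num by rewrite /= invr_gt0.
have t_lt1 : t%:num < 1 by rewrite /= invf_lt1// ltr1n.
have Lp : p \in sublevel A f (f p0) by rewrite inE; split=> //; exact: p_min.
have Lq : q \in sublevel A f (f p0) by rewrite inE; split=> //; exact: q_min.
have := f_sconvex t t_gt0 t_lt1 p q Lp Lq pq.
by rewrite fpq convmm ltNge q_min.
Qed.

(* f : U -> R is represented by a total function of which only the values on
   U matter. *)
Theorem corollary1 (R : realType) (n : nat) (C U : set 'rV[R]_n)
    (f : 'rV[R]_n -> R)
    (C_neq0 : C !=set0) (C_compact : compact C) (C_convex : convex_set C)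
    (U_open : open U) (U_convex : convex_set U)
    (CU_neq0 : C `&` U !=set0)
    (f_C2 : class_C 2 U f) (f_convex : convex_function U f)
    (blow_up : forall a : R, sublevel (C `&` U) f a !=set0 ->
       (0 < dist (sublevel (C `&` U) f a) (~` U))%E) :
  (exists p, minimizer (C `&` U) f p) /\
  (forall p0, (C `&` U) p0 ->
     strictly_convex_function (sublevel (C `&` U) f (f p0)) f ->
     exists! p, minimizer (C `&` U) f p).
Proof.
have [f_cont _] := f_C2.
have ex_min : exists p, minimizer (C `&` U) f p.
  have [p1 CUp1] := CU_neq0.
  have L_neq0 : sublevel (C `&` U) f (f p1) !=set0 by exists p1.
  apply: (minimizer_exists _ _ _ _ _ L_neq0); last by move=> p [_ /f_cont].
  exact: (sublevel_compact _ _ _ _ _ _ C_compact f_cont (blow_up _ L_neq0)).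
split=> // p0 CUp0 f_sconvex; have [p p_min] := ex_min.
have CU_convex : convex_set (C `&` U).
  move=> x y t; rewrite !in_setI => /andP[Cx Ux] /andP[Cy Uy].
  by rewrite C_convex// U_convex.
exists p; split=> // q.
exact: (minimizer_unique _ _ _ _ _ _ _ CU_convex CUp0 f_sconvex p_min).
Qed.
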